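(* Let $R$ be a commutative ring, let $M$ be an arithmetical $R$-module and let $N$ be a proper submodule of $M$. Then the following statements are equivalent: (i) $N$ is strongly irreducible. (ii) $N$ is primal. (iii) $N$ is irreducible.
   Context: All rings are commutative with non-zero identity. An $R$-module $M$ is arithmetical if for each maximal ideal $\mathfrak m$ of $R$ the $R_{\mathfrak m}$-module $M_{\mathfrak m}$ is uniserial, i.e. its submodules are linearly ordered by inclusion. A submodule $N$ of $M$ is strongly irreducible if for all submodules $K,L$ of $M$, $K\cap L\subseteq N$ implies $K\subseteq N$ or $L\subseteq N$. $N$ is irreducible if $N$ is not the intersection of two submodules of $M$ that properly contain it. A proper submodule $N$ of $M$ is primal if $Z_R(M/N)=\{r\in R: rx\in N \text{ for some } x\in M\setminus N\}$, the set of zero-divisors on $M/N$, is an ideal of $R$. *)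

(* Defs.v *)
From HB Require Import structures.
From mathcomp Require Import all_boot all_order all_algebra.
From mathcomp Require Import ring boolp.

Set Implicit Arguments.
Unset Strict Implicit.
Unset Printing Implicit Defensive.

Import GRing.Theory.
Local Open Scope ring_scope.
Local Open Scope quotient_scope.

(* S^-1 M for a multiplicatively closed subset S of R and an R-module M: the *)
(* fractions x / s (x in M, s in S) modulo                                   *)
(*   x / s ~ y / t  iff  u (t x) = u (s y) for some u in S.                  *)
(* S may contain 0, in which case S^-1 R is trivial, hence the use of        *)
(* possibly-zero rings. The ring S^-1 R has the same underlying abelian      *)
(* group as the localization of the regular module R^o; its product and its  *)
(* action on S^-1 M are both given by (a / s) (x / t) = (a x) / (s t).       *)
Section Localization.
Variables (R : comPzRingType) (S : mulrClosed R).

Definition denom := {s : R | s \in S}.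

Definition denom1 : denom := exist _ 1 (rpred1 S).
Fact denomM_subproof (s t : denom) : sval s * sval t \in S.
Proof. by rewrite rpredM ?(svalP s) ?(svalP t). Qed.
Definition denomM (s t : denom) : denom :=
  exist _ (sval s * sval t) (denomM_subproof s t).

Section Fractions.
Variable M : lmodType R.
Implicit Types (x y z : M) (s t : denom).

Let preFrac : choiceType := (M * {s : R | s \in S})%type.

Definition loc_equiv (p q : preFrac) : bool :=
  `[< exists2 u, u \in S & u *: (sval q.2 *: p.1) = u *: (sval p.2 *: q.1) >].

Fact loc_equiv_class : equiv_class_of loc_equiv.
Proof.
split=> [p|p q|q p r].
- by apply/asboolP; exists 1; rewrite ?rpred1.
- by apply/asboolP/asboolP => -[u Su e]; exists u.
- move=> /asboolP[u Su e1] /asboolP[v Sv e2]; apply/asboolP.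
  exists (u * v * sval q.2); first by rewrite !rpredM // (svalP q.2).
  transitivity ((v * sval r.2) *: (u *: (sval q.2 *: p.1))).
    by rewrite !scalerA; congr (_ *: _); ring.
  rewrite e1; transitivity ((u * sval p.2) *: (v *: (sval r.2 *: q.1))).
    by rewrite !scalerA; congr (_ *: _); ring.
  by rewrite e2 !scalerA; congr (_ *: _); ring.
Qed.

Canonical loc_equiv_equiv := EquivRelPack loc_equiv_class.
Canonical loc_equiv_enc := defaultEncModRel loc_equiv.

Definition locMod := {eq_quot loc_equiv}.
HB.instance Definition _ := EqQuotient.on locMod.
HB.instance Definition _ := Choice.on locMod.

Definition mkfrac x s : locMod := \pi_locMod (x, s).

Lemma mkfracP x y s t :
  mkfrac x s = mkfrac y t <->
  exists2 u, u \in S & u *: (sval t *: x) = u *: (sval s *: y).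
Proof.
split=> [/eqP|h]; first by rewrite /mkfrac piE => /asboolP.
by apply/eqP; rewrite /mkfrac piE; apply/asboolP.
Qed.

Lemma mkfracW (P : locMod -> Prop) :
  (forall x s, P (mkfrac x s)) -> forall a, P a.
Proof. by move=> h a; rewrite -[a]reprK; case: (repr a). Qed.

Lemma mkfrac_repr (a : locMod) : mkfrac (repr a).1 (repr a).2 = a.
Proof. by rewrite /mkfrac -surjective_pairing reprK. Qed.

Definition loc_add (a b : locMod) : locMod :=
  locked (mkfrac (sval (repr b).2 *: (repr a).1 + sval (repr a).2 *: (repr b).1)
               (denomM (repr a).2 (repr b).2)).
Definition loc_opp (a : locMod) : locMod :=
  locked (mkfrac (- (repr a).1) (repr a).2).

Lemma loc_addE x y s t :
  loc_add (mkfrac x s) (mkfrac y t) =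
  mkfrac (sval t *: x + sval s *: y) (denomM s t).
Proof.
have /mkfracP[u Su e] := mkfrac_repr (mkfrac x s).
have /mkfracP[v Sv f] := mkfrac_repr (mkfrac y t).
rewrite /loc_add -lock.
move: (repr _) e (repr _) f => [x' s'] /= e [y' t'] /= f.
apply/mkfracP; exists (u * v); rewrite ?rpredM //= !scalerDr.
congr (_ + _).
  transitivity ((v * sval t * sval t') *: (u *: (sval s *: x'))).
    by rewrite !scalerA; congr (_ *: _); ring.
  by rewrite e !scalerA; congr (_ *: _); ring.
transitivity ((u * sval s * sval s') *: (v *: (sval t *: y'))).
  by rewrite !scalerA; congr (_ *: _); ring.
by rewrite f !scalerA; congr (_ *: _); ring.
Qed.

Lemma loc_oppE x s : loc_opp (mkfrac x s) = mkfrac (- x) s.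
Proof.
have /mkfracP[u Su e] := mkfrac_repr (mkfrac x s).
by rewrite /loc_opp -lock; apply/mkfracP; exists u; rewrite // !scalerN e.
Qed.

Fact loc_addA : associative loc_add.
Proof.
elim/mkfracW=> x s; elim/mkfracW=> y t; elim/mkfracW=> z r.
rewrite !loc_addE.
apply/mkfracP; exists 1; rewrite ?rpred1 //= !scalerDr !scalerA addrA.
by congr (_ *: _ + _ *: _ + _ *: _); ring.
Qed.

Fact loc_addC : commutative loc_add.
Proof.
elim/mkfracW=> x s; elim/mkfracW=> y t; rewrite !loc_addE.
apply/mkfracP; exists 1; rewrite ?rpred1 //= addrC !scalerDr !scalerA.
by congr (_ *: _ + _ *: _); ring.
Qed.

Fact loc_add0 : left_id (mkfrac 0 denom1) loc_add.
Proof.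
elim/mkfracW=> x s; rewrite !loc_addE.
apply/mkfracP; exists 1; rewrite ?rpred1 //= scaler0 add0r !scalerA.
by congr (_ *: _); ring.
Qed.

Fact loc_addN : left_inverse (mkfrac 0 denom1) loc_opp loc_add.
Proof.
elim/mkfracW=> x s; rewrite loc_oppE !loc_addE.
by apply/mkfracP; exists 1; rewrite ?rpred1 //= scalerN addNr !scaler0.
Qed.

HB.instance Definition _ :=
  GRing.isZmodule.Build locMod loc_addA loc_addC loc_add0 loc_addN.

Lemma mkfrac_add x y s t :
  mkfrac x s + mkfrac y t = mkfrac (sval t *: x + sval s *: y) (denomM s t).
Proof. exact: loc_addE. Qed.

Lemma mkfrac_opp x s : - mkfrac x s = mkfrac (- x) s.
Proof. exact: loc_oppE. Qed.

Lemma mkfrac_zero : 0 = mkfrac 0 denom1. Proof. by []. Qed.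
End Fractions.

Section Action.
Variable M : lmodType R.
Implicit Types (x y z : M) (s t : denom).

Definition loc_act (a : locMod R^o) (b : locMod M) : locMod M :=
  locked (mkfrac (((repr a).1 : R) *: (repr b).1)
               (denomM (repr a).2 (repr b).2)).

Lemma loc_actE (a : R^o) x s t :
  loc_act (mkfrac a s) (mkfrac x t) = mkfrac ((a : R) *: x) (denomM s t).
Proof.
have /mkfracP[u Su e] := mkfrac_repr (mkfrac a s).
have /mkfracP[v Sv f] := mkfrac_repr (mkfrac x t).
rewrite /loc_act -lock.
move: (repr _) e (repr _) f => [a' s'] /= e [x' t'] /= f.
have {}e : u * (sval s * a') = u * (sval s' * a) := e.
apply/mkfracP; exists (u * v); rewrite ?rpredM //=.
transitivity ((u * (sval s * a')) *: (v *: (sval t *: x'))).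
  by rewrite !scalerA; congr (_ *: _); ring.
by rewrite e f !scalerA; congr (_ *: _); ring.
Qed.

Lemma loc_actDr a : {morph loc_act a : b c / b + c}.
Proof.
elim/mkfracW: a => a s; elim/mkfracW=> x t; elim/mkfracW=> y r.
rewrite mkfrac_add !loc_actE mkfrac_add.
apply/mkfracP; exists 1; rewrite ?rpred1 //=.
rewrite !scalerDr !scalerA; congr (_ *: _ + _ *: _); ring.
Qed.

Lemma loc_actDl b : {morph loc_act^~ b : a c / a + c}.
Proof.
elim/mkfracW: b => x t; elim/mkfracW=> a s; elim/mkfracW=> c r.
rewrite mkfrac_add !loc_actE mkfrac_add.
apply/mkfracP; exists 1; rewrite ?rpred1 //=.
rewrite [X in X *: x](_ : _ = (sval r * a + sval s * c)) //.
rewrite !scalerDr !scalerA -!scalerDl; congr (_ *: _); ring.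
Qed.

Lemma loc_act1 : left_id (mkfrac (1 : R^o) denom1) loc_act.
Proof.
elim/mkfracW=> x t; rewrite loc_actE.
apply/mkfracP; exists 1; rewrite ?rpred1 //=.
by rewrite mul1r !scale1r.
Qed.
End Action.

Lemma loc_actA (M : lmodType R) (a b : locMod R^o) (c : locMod M) :
  loc_act a (loc_act b c) = loc_act (loc_act a b) c.
Proof.
elim/mkfracW: a => a s; elim/mkfracW: b => b t; elim/mkfracW: c => x r.
rewrite !loc_actE.
apply/mkfracP; exists 1; rewrite ?rpred1 //=.
change (a *: b) with ((a : R) * b).
rewrite !scalerA; congr (_ *: _); ring.
Qed.

Definition locRing := locMod R^o.
HB.instance Definition _ := GRing.Zmodule.on locRing.

Fact loc_mulA : associative (@loc_act R^o).
Proof. by move=> a b c; apply: loc_actA. Qed.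
Fact loc_mulC : commutative (@loc_act R^o).
Proof.
elim/mkfracW=> a s; elim/mkfracW=> b t; rewrite !loc_actE; apply/mkfracP.
exists 1; rewrite ?rpred1 //=; congr (_ *: _).
change ((sval t * sval s) * (a * b) = (sval s * sval t) * (b * a) :> R); ring.
Qed.
Fact loc_mulDl : left_distributive (@loc_act R^o) +%R.
Proof. by move=> a b c; apply: loc_actDl. Qed.

HB.instance Definition _ := GRing.Zmodule_isComPzRing.Build locRing
  loc_mulA loc_mulC (@loc_act1 R^o) loc_mulDl.

Fact loc_scaleDl (M : lmodType R) (b : locMod M) :
  {morph (fun a : locRing => @loc_act M a b) : a c / a + c}.
Proof. exact: loc_actDl. Qed.

HB.instance Definition _ (M : lmodType R) :=
  GRing.Zmodule_isLmodule.Build locRing (locMod M)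
    (@loc_actA M) (@loc_act1 M) (@loc_actDr M) (@loc_scaleDl M).

Lemma mkfrac_one : 1 = mkfrac (1 : R^o) denom1 :> locRing. Proof. by []. Qed.

Lemma mkfrac_mul (a b : R) (s t : denom) :
  (mkfrac (a : R^o) s : locRing) * (mkfrac (b : R^o) t : locRing) =
  mkfrac (a * b : R^o) (denomM s t).
Proof. exact: loc_actE. Qed.

Lemma mkfrac_scale (M : lmodType R) (a : R) (x : M) (s t : denom) :
  (mkfrac (a : R^o) s : locRing) *: mkfrac x t = mkfrac (a *: x) (denomM s t).
Proof. exact: loc_actE. Qed.
End Localization.

Arguments denom1 {R S}.

Definition maximal_ideal (R : nzRingType) (m : idealr R) : Prop :=
  forall J : idealr R, {subset m <= J} -> {subset J <= m}.

Record maxIdeal (R : nzRingType) := MaxIdeal {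
  max_ideal :> idealr R;
  max_idealP : maximal_ideal max_ideal
}.

Section MaximalComplement.
Variables (R : comNzRingType) (m : maxIdeal R).

Definition compl_ideal : {pred R} := [pred s | s \notin m].

Fact compl_ideal_mulr_closed : GRing.mulr_closed compl_ideal.
Proof.
split=> [|s t]; rewrite !inE ?idealr1 // => sNm tNm.
apply: contra sNm => stm.
pose J : {pred R} := [pred x | x * t \in m].
have J_ideal : idealr_closed J.
  split=> [||a x y].
  - by rewrite inE mul0r rpred0.
  - by rewrite inE mul1r.
  - by rewrite !inE mulrDl -mulrA => xtm ytm; rewrite rpredD //; exact: idealMr.
pose J' : idealr R := HB.pack J (isIdealr.Build R J J_ideal).
apply: (max_idealP (m := m) (J := J')) => //.
by move=> x xm; rewrite /J' inE /= mulrC; exact: idealMr.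
Qed.

HB.instance Definition _ :=
  GRing.isMulClosed.Build R compl_ideal compl_ideal_mulr_closed.

End MaximalComplement.

Definition uniserial (R : pzRingType) (V : lmodType R) : Prop :=
  forall K L : submodClosed V, {subset K <= L} \/ {subset L <= K}.

Definition arithmetical (R : comNzRingType) (M : lmodType R) : Prop :=
  forall m : maxIdeal R, uniserial (locMod (compl_ideal m) M).

Section Submodules.
Variables (R : comNzRingType) (M : lmodType R).
Implicit Types N K L : submodClosed M.

Definition proper_submod N : Prop := exists x, x \notin N.

Definition strongly_irreducible N : Prop :=
  forall K L, {subset [predI K & L] <= N} ->
    {subset K <= N} \/ {subset L <= N}.

Definition properly_contained N K : Prop :=
  {subset N <= K} /\ ~ {subset K <= N}.

Definition irreducible_submod N : Prop :=
  ~ exists K L, [/\ properly_contained N K, properly_contained N L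
                  & N =i [predI K & L]].

Definition zero_divisors N : {pred R} :=
  [pred r | `[< exists2 x, x \notin N & r *: x \in N >]].

(* Ideals of R are the submodules of R^o. *)
Definition primal N : Prop :=
  submod_closed (zero_divisors N : {pred R^o}).
End Submodules.

(* Main.v *)
Require Import Defs.
From mathcomp Require Import all_boot all_order all_algebra.
From HB Require Import structures.
From mathcomp Require Import boolp classical_sets.

(* Irreducible implies primal: if r and s kill nonzero elements of M/N, the   *)
(* colon submodules (N : r) and (N : s) properly contain N, hence so does     *)
(* their intersection by irreducibility; its elements outside N are killed by *)
(* r + s modulo N.                                                            *)
(* Primal implies strongly irreducible: if x in K and y in L lie outside N,   *)
(* let m be a maximal ideal containing the zero-divisors of M/N. As M_m is    *)
(* uniserial, some s outside m satisfies s x in R y or s y in R x, and this   *)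
(* element lies in K and L but not in N, s not being a zero-divisor.          *)

Set Implicit Arguments.
Unset Strict Implicit.
Unset Printing Implicit Defensive.

Import GRing.Theory.
Local Open Scope ring_scope.

Section Cyclic.
Variables (R : pzRingType) (V : lmodType R) (v : V).

Definition cyclic_submod : {pred V} :=
  [pred w | `[< exists a : R, w = a *: v >]].

Fact cyclic_submod_closed : submod_closed cyclic_submod.
Proof.
split=> [|c _ _ /asboolP[a ->] /asboolP[b ->]]; apply/asboolP.
  by exists 0; rewrite scale0r.
by exists (c * a + b); rewrite scalerDl scalerA.
Qed.

HB.instance Definition _ :=
  GRing.isSubmodClosed.Build R V cyclic_submod cyclic_submod_closed.

Lemma mem_cyclic_submod : v \in cyclic_submod.
Proof. by apply/asboolP; exists 1; rewrite scale1r. Qed.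
End Cyclic.

Lemma uniserial_cyclic (R : pzRingType) (V : lmodType R) (x y : V) :
  uniserial V -> (exists a : R, x = a *: y) \/ (exists a : R, y = a *: x).
Proof.
move=> /(_ (cyclic_submod x) (cyclic_submod y))[sub|sub].
  by left; apply/asboolP/sub/mem_cyclic_submod.
by right; apply/asboolP/sub/mem_cyclic_submod.
Qed.

Section LocalCyclic.
Variables (R : comPzRingType) (S : mulrClosed R) (M : lmodType R).

(** Clearing denominators: if [c] is [a / t], equality of the two fractions means [u t x = u a y]
    for some [u] in [S], and [u t] serves as [s]. *)
Lemma locMod_multiple (x y : M) (c : locRing S) :
    mkfrac x (@denom1 R S) = c *: mkfrac y denom1 ->
  exists2 s : R, s \in S & exists a : R, s *: x = a *: y.
Proof.
elim/mkfracW: c => a t; rewrite mkfrac_scale => /mkfracP[u Su e].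
exists (u * sval t); first by rewrite rpredM ?(svalP t).
by exists (u * a); move: e; rewrite /= mulr1 scale1r !scalerA.
Qed.

Lemma locMod_uniserial_multiple (x y : M) : uniserial (locMod S M) ->
  exists2 s : R, s \in S &
    (exists a : R, s *: x = a *: y) \/ (exists a : R, s *: y = a *: x).
Proof.
move=> uM; have [] := uniserial_cyclic (mkfrac x denom1) (mkfrac y denom1) uM.
  by case=> c /locMod_multiple[s Ss h]; exists s; [|left].
by case=> c /locMod_multiple[s Ss h]; exists s; [|right].
Qed.
End LocalCyclic.

Lemma idealr_closedP (R : nzRingType) (I : idealr R) : idealr_closed I.
Proof.
by split=> [||a x y Ix Iy]; rewrite ?rpred0 ?idealr1 // rpredD ?idealMr.
Qed.

Section Krull.
Variables (R : comNzRingType) (I : idealr R).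

(* Plain predicates: the type idealr R lives in too large a universe for the  *)
(* Zorn lemma of the library.                                                 *)
Let over := {J : R -> bool | idealr_closed J /\ {subset I <= J}}.
Let le (J K : over) : bool := `[< {subset sval J <= sval K} >].

(** Krull's theorem, by Zorn's lemma on the proper ideals containing [I]. *)
Lemma maxIdeal_exists : exists m : maxIdeal R, {subset I <= m}.
Proof.
pose t0 : over :=
  exist _ (I : R -> bool) (conj (idealr_closedP I) (fun x Ix => Ix)).
have [|||[J [J_ideal IJ]] Jmax] := @ZL_preorder over t0 le.
- by move=> J; apply/asboolP.
- by move=> J K L /asboolP JK /asboolP KL; apply/asboolP=> x /JK/KL.
- move=> C Ctot; have [[J0 CJ0]|C0] := pselect (exists J, C J); last first.
    (* The empty chain is bounded by [I] itself, since its union would not contain [I]. *)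
    by exists t0 => J CJ; case: C0; exists J.
  pose U : R -> bool := [pred x | `[< exists2 J, C J & x \in sval J >]].
  have U_ideal : idealr_closed U.
    split=> [||a x y /asboolP[J CJ Jx] /asboolP[K CK Ky]].
    - by apply/asboolP; exists J0 => //; have [[]] := svalP J0.
    - by apply/asboolP => -[J _]; have [[_ /negPf->]] := svalP J.
    (* As the chain is total, [x] and [y] both lie in the larger of [J] and [K]. *)
    - have [[_ _ Jlin] _] := svalP J; have [[_ _ Klin] _] := svalP K.
      have [/asboolP JK|/asboolP KJ] := Ctot _ _ CJ CK; apply/asboolP.
        by exists K => //; apply: Klin => //; apply: JK.
      by exists J => //; apply: Jlin => //; apply: KJ.
  have IU : {subset I <= U}.
    by move=> x Ix; apply/asboolP; exists J0 => //; apply: (svalP J0).2.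
  exists (exist _ U (conj U_ideal IU)) => J CJ.
  by apply/asboolP=> x Jx; apply/asboolP; exists J.
pose J' : idealr R := HB.pack J (isIdealr.Build R J J_ideal).
have Jmaximal : maximal_ideal J'.
  move=> K JK; have IK : {subset I <= K} by move=> x /IJ/JK.
  pose K' : over := exist _ (K : R -> bool) (conj (idealr_closedP K) IK).
  by apply/asboolP/(Jmax K')/asboolP.
by exists (MaxIdeal Jmaximal).
Qed.
End Krull.

Section Colon.
Variables (R : comNzRingType) (M : lmodType R) (N : submodClosed M) (r : R).

Definition colon_submod : {pred M} := [pred x | r *: x \in N].

Fact colon_submod_closed : submod_closed colon_submod.
Proof.
split=> [|c x y]; rewrite !inE ?scaler0 ?rpred0 // => Nx Ny.
by rewrite scalerDr scalerA mulrC -scalerA; apply: rpredD => //; apply: rpredZ.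
Qed.

HB.instance Definition _ :=
  GRing.isSubmodClosed.Build R M colon_submod colon_submod_closed.

Lemma zero_divisors_colon :
  r \in zero_divisors N -> properly_contained N colon_submod.
Proof.
case/asboolP=> x Nx Nrx; split=> [y Ny|sub]; first by rewrite inE rpredZ.
by case/negP: Nx; apply: sub.
Qed.
End Colon.

Section Equivalence.
Variables (R : comNzRingType) (M : lmodType R) (N : submodClosed M).

(** If [N] is the intersection of [K] and [L], strong irreducibility puts one of them inside [N], so
    they cannot both contain [N] properly. *)
Lemma strongly_irreducible_irreducible :
  strongly_irreducible N -> irreducible_submod N.
Proof.
move=> sN [K [L [[_ KN] [_ LN] eN]]].
by have [|//|//] := sN K L; move=> x; rewrite eN.
Qed.

Lemma irreducible_primal :
  proper_submod N -> irreducible_submod N -> primal N.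
Proof.
move=> [x0 Nx0] iN; split=> [|a r s /= Zr Zs].
  (* Properness of [N] enters here: 0 is a zero-divisor because it kills [x0] modulo [N]. *)
  by apply/asboolP; exists x0; rewrite // scale0r rpred0.
have {}iN : ~ N =i [predI colon_submod N r & colon_submod N s].
  move=> eN; apply: iN.
  exists (colon_submod N r : submodClosed M).
  exists (colon_submod N s : submodClosed M).
  by split=> //; apply: zero_divisors_colon.
(* If [a * r + s] were not a zero-divisor, every [z] killed by both [r] and [s] modulo [N] would lie
   in [N], so the two colons would meet exactly in [N]. *)
apply/asboolP; apply: contrapT => noz; apply: iN => z; apply/idP/idP => [Nz|].
  by rewrite !inE !rpredZ.
move=> /andP[/= Nrz Nsz]; apply/negPn/negP => Nz; apply: noz; exists z => //.
rewrite [X in X *: z](_ : _ = a * r + s) // scalerDl -scalerA.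
by apply: rpredD => //; apply: rpredZ.
Qed.

(** The zero-divisors form a proper ideal, since 1 kills nothing nonzero in [M/N]; hence some
    maximal ideal contains them. *)
Lemma zero_divisors_idealr_closed : primal N -> idealr_closed (zero_divisors N).
Proof.
case=> Z0 ZD; split=> //.
by apply/asboolP => -[x Nx]; rewrite scale1r (negPf Nx).
Qed.

Lemma primal_strongly_irreducible :
  arithmetical M -> primal N -> strongly_irreducible N.
Proof.
move=> aM pN K L KLN; apply: contrapT => /not_orP[KN LN].
have witness (P : submodClosed M) :
    ~ {subset P <= N} -> exists2 x, x \in P & x \notin N.
  move=> PN; apply: contrapT => noz; apply: PN => x Px.
  by apply/negPn/negP => Nx; apply: noz; exists x.
have [[x Kx Nx] [y Ly Ny]] := (witness _ KN, witness _ LN).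
pose Z : idealr R := HB.pack (zero_divisors N : {pred R})
  (isIdealr.Build R (zero_divisors N) (zero_divisors_idealr_closed pN)).
have [m Zm] := maxIdeal_exists Z.
have [s ms sxy] := locMod_uniserial_multiple x y (aM m).
have regular z : z \notin N -> s *: z \notin N.
  move=> Nz; apply: contra ms => Nsz; apply: Zm.
  by apply/asboolP; exists z.
case: sxy => -[a e].
  by case/negP: (regular x Nx); apply: KLN; rewrite inE /= rpredZ //= e rpredZ.
case/negP: (regular y Ny); apply: KLN.
by rewrite inE /= andbC rpredZ //= e rpredZ.
Qed.
End Equivalence.

Theorem theorem1p2 (R : comNzRingType) (M : lmodType R) (N : submodClosed M) :
  arithmetical M -> proper_submod N ->
  (strongly_irreducible N <-> primal N) /\ (primal N <-> irreducible_submod N).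
Proof.
move=> aM pN.
have si := @strongly_irreducible_irreducible R M N.
have ip := irreducible_primal pN.
have ps := primal_strongly_irreducible (N := N) aM.
by split; [split=> [/si/ip|/ps]|split=> [/ps/si|/ip]].
Qed.
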